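(* Let $A$ be a symmetric nonnegative matrix of size $n\times n$ with $n\geq 7$, with $|A|_{\infty}\leq 1$, and with zero diagonal. Then $$\|A\|_{*}+\|J_{n}-I_{n}-A\|_{*}\leq (n-1)\left(1+\sqrt{n}\right),$$ with equality holding if and only if $A$ is the adjacency matrix of a conference graph.
   Context: Matrices are real, and nonnegative means entrywise nonnegative. $I_n$ is the $n\times n$ identity matrix and $J_n$ is the $n\times n$ all-ones matrix. $|A|_{\infty}$ is the maximum of the absolute values of the entries of $A$. The trace norm $\|A\|_{*}$ is the sum of the singular values of $A$. Graphs are finite, simple and undirected. A strongly regular graph with parameters $(n,d,\lambda,\mu)$ is a $d$-regular graph of order $n$ in which every two distinct adjacent vertices have exactly $\lambda$ common neighbours and every two distinct nonadjacent vertices have exactly $\mu$ common neighbours. A conference graph of order $n$ is a strongly regular graph with parameters $\left(n,(n-1)/2,(n-5)/4,(n-1)/4\right)$. *)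

(* Defs.v *)
From mathcomp Require Import all_boot all_order all_algebra.
From mathcomp Require Import polyorder polyrcf.
From mathcomp Require Import reals matrix_normedtype.

Set Implicit Arguments.
Unset Strict Implicit.
Unset Printing Implicit Defensive.

Import Order.TTheory GRing.Theory Num.Theory.

Local Open Scope ring_scope.

(* Only the eigenvalues lying in R, with algebraic multiplicity: this is the
   whole spectrum for symmetric M, in particular for the matrix A^T *m A. *)
Definition eigenvalues (R : realType) (n : nat) (M : 'M[R]_n) : seq R :=
  flatten [seq nseq (\mu_x (char_poly M)) x | x <- rootsR (char_poly M)].

Definition singular_values (R : realType) (n : nat) (A : 'M[R]_n) : seq R :=
  [seq Num.sqrt x | x <- eigenvalues (A^T *m A)].

Definition trace_norm (R : realType) (n : nat) (A : 'M[R]_n) : R :=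
  \sum_(s <- singular_values A) s.

Definition simple_graph (T : finType) (e : rel T) : Prop :=
  symmetric e /\ irreflexive e.

Definition common_nbrs (T : finType) (e : rel T) (x y : T) : {set T} :=
  [set z | e x z && e y z].

Definition strongly_regular (T : finType) (e : rel T) (n d l m : nat) : Prop :=
  [/\ simple_graph e,
      #|T| = n,
      forall x, #|[set y | e x y]| = d,
      forall x y, x != y -> e x y -> #|common_nbrs e x y| = l &
      forall x y, x != y -> ~~ e x y -> #|common_nbrs e x y| = m].

(* The parameters (n - 1) / 2, (n - 5) / 4 and (n - 1) / 4 are exact quotients,
   so they are given by equations free of truncated subtraction and division. *)
Definition conference_graph (T : finType) (e : rel T) (n : nat) : Prop :=
  exists d l m : nat,
    [/\ (2 * d + 1 = n)%N, (4 * l + 5 = n)%N, (4 * m + 1 = n)%N &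
        strongly_regular e n d l m].

Definition adjacency_mx (R : realType) (n : nat) (e : rel 'I_n) : 'M[R]_n :=
  \matrix_(i, j) (e i j)%:R.

(* Main.v *)
Require Import Defs.
From mathcomp Require Import all_boot all_order all_algebra.
From mathcomp Require Import polyorder polyrcf complex.
From mathcomp Require Import reals matrix_normedtype.
From mathcomp Require Import zify ring lra.

Set Implicit Arguments.
Unset Strict Implicit.
Unset Printing Implicit Defensive.

Import Order.TTheory GRing.Theory Num.Theory.

Local Open Scope ring_scope.

(** Write J for the all-ones matrix, B = J - I - A, and C = A - B = 2A - J + I.

The trace norm of a symmetric matrix M is the maximum of tr (Q M) over
orthogonal Q, and it is attained at a symmetric involution, the sign of M
([trace_norm_attained], [mxtrace_orthogonal_le]).  Take symmetric involutions
S for A and T for B, and put P = (S + T) / 2 and D = (S - T) / 2.  Then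
P^2 + D^2 = I, P D + D P = 0, and the quantity to be bounded is
  tr (S A) + tr (T B) = tr (P J) - tr P + tr (D C).

Let p = tr (P J) / n, which is the Rayleigh quotient of P at the normalized
constant vector u, t = tr P and q = tr P^2, so that tr D^2 = n - q.  Completing
the square in sqrt n D - C, and using tr C^2 <= n (n - 1), bounds tr (D C) by
(n - 1) sqrt n + (1 - q) sqrt n / 2.  What remains is
  n (1 - p) + (t - 1) + (q - 1) sqrt n / 2 >= 0.
The Cauchy-Schwarz bound q >= p^2 + (t - p)^2 / (n - 1) is too weak for this: it
only leads to sqrt (n + 1) in place of sqrt n.  The additional information is
that tr P = tr P^3, because D anticommutes with P.  As -I <= P <= I, it yields
q - t = tr (P (I - P) P) >= 0, and q + t = tr (P (I + P) P) is at least the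
Rayleigh quotient of P^3 + P^2 at u, hence at least 5 p - 3 by the tangent line
inequality x^3 + x^2 - 5 x + 3 = (x - 1)^2 (x + 3) >= 0.  A combination of these
two inequalities and p <= 1 is the inequality wanted, as soon as
5 (1 + sqrt n / 2) < 2 n, that is for n >= 7 ([reflection_defect],
[trace_norm_complement_extremal]).

In the case of equality p = q = 1, so P = J / n, while sqrt n D = C and the
entries of A are 0 or 1; then P^2 + D^2 = I becomes C^2 = n I - J.  For the
adjacency matrix of a graph this equation says exactly that the graph is a
conference graph ([conference_seidel_sqr], [seidel_sqr_conference]).
Conversely, when C^2 = n I - J, the orthogonal matrices
J / n + C / sqrt n and J / n - C / sqrt n show that the bound is reached
([conference_trace_norm_ge]). *)

(** * Trace norm of a symmetric matrix *)

(** The spectral theorem over R[i] gives a complex diagonalization with real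
eigenvalues; a real base change exists because two real matrices that are
similar over R[i] are similar over R. *)
Lemma symmetric_diagonalizable (R : rcfType) (n : nat) (A : 'M[R]_n) :
  A^T = A ->
  exists2 V : 'M[R]_n, V \in unitmx &
    exists d : 'rV[R]_n, V *m A = diag_mx d *m V.
Proof.
move=> A_sym; pose emb : {rmorphism R -> R[i]} := real_complex R.
have embK (x : R[i]) : x \is Num.real -> emb (complex.Re x) = x.
  exact: RRe_real.
have AC_sym : map_mx emb A \is symmetricmx.
  by apply/is_hermitianmxP; rewrite expr0 scale1r map_mx_id // map_trmx A_sym.
have AC_real : map_mx emb A \is a mxOver Num.real.
  by apply/mxOverP => i j; rewrite mxE; apply/complex_realP; exists (A i j).
have AC_herm := realsym_hermsym AC_sym AC_real.
have d_real := hermitian_spectral_diag_real AC_herm.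
set d := spectral_diag _ in d_real.
have := hermitian_normalmx AC_herm => /orthomx_spectralP.
rewrite -/d => AC_spec.
have sim : similar_in unitmx (map_mx emb A) (diag_mx d).
  exists (spectralmx (map_mx emb A)); first exact: spectral_unit.
  apply/similarP; first exact: spectral_unit.
  by rewrite {2}AC_spec !mulmxA mulmxV ?spectral_unit // mul1mx.
have diag_real : diag_mx d \is a mxOver Num.real.
  apply/mxOverP => i j; rewrite mxE.
  by case: (i == j); rewrite ?mulr1n ?mulr0n ?rpred0 // (mxOverP d_real).
have [P /andP [P_real P_unit]] := real_similar sim AC_real diag_real.
move=> /(similarP P_unit) PA.
have liftRe p q (M : 'M[R[i]]_(p, q)) :
    M \is a mxOver Num.real -> map_mx emb (map_mx (@complex.Re R) M) = M.
  by move=> /mxOverP MR; apply/matrixP => i j; rewrite !mxE embK.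
exists (map_mx (@complex.Re R) P).
  by rewrite -(map_unitmx emb) liftRe.
exists (map_mx (@complex.Re R) d); apply: (@map_mx_inj _ _ emb).
by rewrite !map_mxM map_diag_mx !liftRe.
Qed.

Lemma mu_prod_XsubC (R : realType) (s : seq R) (x : R) :
  \mu_x (\prod_(z <- s) ('X - z%:P)) = count_mem x s.
Proof.
elim: s => [|z s IHs]; first by rewrite big_nil mu_polyC.
rewrite big_cons mu_mul; last first.
  by rewrite mulf_neq0 ?polyXsubC_eq0 // monic_neq0 ?monic_prod_XsubC.
rewrite IHs /=; congr addn; have [->|zNx] := eqVneq z x; first exact: mu_XsubC.
by apply: muNroot; rewrite root_XsubC eq_sym.
Qed.

Lemma sum_eigenvalues (R : realType) (n : nat) (M : 'M[R]_n) (s : seq R)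
    (f : R -> R) :
  char_poly M = \prod_(z <- s) ('X - z%:P) ->
  \sum_(x <- eigenvalues M) f x = \sum_(z <- s) f z.
Proof.
move=> charM; apply: perm_big; apply/allP => x _ /=; apply/eqP.
rewrite /eigenvalues charM count_flatten -map_comp sumnE big_map.
set p := \prod_(z <- s) _.
have p_neq0 : p != 0 by rewrite monic_neq0 ?monic_prod_XsubC.
have -> : (\sum_(y <- rootsR p) (count_mem x \o (fun y => nseq (\mu_y p) y)) y
  = \sum_(y <- rootsR p | y == x) count_mem x s)%N.
  rewrite [RHS]big_mkcond; apply: eq_bigr => y _ /=.
  rewrite count_nseq /= mu_prod_XsubC; case: eqVneq => [->|_] /=; last by [].
  by rewrite mul1n.
rewrite -big_filter big_const_seq count_predT.
have := roots_on_rootsR p_neq0 x; rewrite inE /= root_prod_XsubC => in_roots.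
rewrite size_filter count_uniq_mem ?uniq_roots //.
rewrite -in_roots -has_pred1 has_count.
by case: (count_mem x s) => [|k] /=; rewrite ?addn0.
Qed.

Lemma char_poly_similar_diag (R : realType) (n : nat) (M V : 'M[R]_n)
    (d : 'rV[R]_n) :
  V \in unitmx -> V *m M = diag_mx d *m V ->
  char_poly M = \prod_(z <- [seq d 0 i | i <- enum 'I_n]) ('X - z%:P).
Proof.
move=> V_unit VM; rewrite big_map big_enum /=.
have -> : char_poly M = char_poly (diag_mx d).
  have VX_unit : \det (map_mx polyC V) != 0.
    by rewrite det_map_mx polyC_eq0 -unitfE -unitmxE.
  apply: (mulfI VX_unit); rewrite [RHS]mulrC -!det_mulmx; congr (\det _).
  rewrite /char_poly_mx mulmxBl mulmxBr -!map_mxM VM.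
  by rewrite scalar_mxC.
rewrite char_poly_trig ?diag_mx_is_trig //.
by apply: eq_bigr => i _; rewrite mxE eqxx mulr1n.
Qed.

(** When V M = diag(d) V, this is the matrix f(M) of the functional calculus. *)
Definition spectral_fun (R : fieldType) (n : nat) (V : 'M[R]_n) (d : 'rV[R]_n)
    (f : R -> R) : 'M[R]_n :=
  invmx V *m diag_mx (map_mx f d) *m V.

Lemma spectral_fun_id (R : fieldType) (n : nat) (A V : 'M[R]_n) (d : 'rV[R]_n) :
  V \in unitmx -> V *m A = diag_mx d *m V -> spectral_fun V d id = A.
Proof.
by move=> V_unit VA; rewrite /spectral_fun map_mx_id // -mulmxA -VA mulKmx.
Qed.

Lemma spectral_fun1 (R : fieldType) (n : nat) (V : 'M[R]_n) (d : 'rV[R]_n) :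
  V \in unitmx -> spectral_fun V d (fun=> 1) = 1%:M.
Proof.
move=> V_unit; rewrite /spectral_fun.
have -> : map_mx (fun=> 1) d = const_mx 1 :> 'rV[R]_n.
  by apply/rowP => i; rewrite !mxE.
by rewrite diag_const_mx mulmx1 mulVmx.
Qed.

Lemma spectral_funM (R : fieldType) (n : nat) (V : 'M[R]_n) (d : 'rV[R]_n)
    (f g : R -> R) :
  V \in unitmx ->
  spectral_fun V d f *m spectral_fun V d g
    = spectral_fun V d (fun x => f x * g x).
Proof.
move=> V_unit; rewrite /spectral_fun !mulmxA mulmxK //.
rewrite -[in LHS](mulmxA (invmx V)); congr (_ *m _ *m _).
rewrite mulmx_diag; congr diag_mx.
by apply/rowP => i; rewrite !mxE.
Qed.

Lemma mxtrace_spectral_fun (R : fieldType) (n : nat) (V : 'M[R]_n)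
    (d : 'rV[R]_n) (f : R -> R) :
  V \in unitmx -> \tr (spectral_fun V d f) = \sum_i f (d 0 i).
Proof.
move=> V_unit; rewrite /spectral_fun mxtrace_mulC mulmxA mulmxV // mul1mx.
by rewrite mxtrace_diag; apply: eq_bigr => i _; rewrite mxE.
Qed.

(** The base change V need not be orthogonal.  Since A is symmetric, the Gram
matrix V V^T commutes with diag(d), so its entry (i, j) vanishes unless
d_i = d_j; hence it commutes with diag(f(d)) as well. *)
Lemma spectral_fun_sym (R : fieldType) (n : nat) (A V : 'M[R]_n)
    (d : 'rV[R]_n) (f : R -> R) :
  A^T = A -> V \in unitmx -> V *m A = diag_mx d *m V ->
  (spectral_fun V d f)^T = spectral_fun V d f.
Proof.
move=> A_sym V_unit VA.
have gram_diag : V *m V^T *m diag_mx d = diag_mx d *m (V *m V^T).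
  rewrite mulmxA -VA -!mulmxA; congr (_ *m _).
  by rewrite -{1}A_sym -trmx_mul VA trmx_mul tr_diag_mx.
have gram_fun :
    V *m V^T *m diag_mx (map_mx f d) = diag_mx (map_mx f d) *m (V *m V^T).
  move: gram_diag; set G := V *m V^T => /matrixP gram_diag.
  apply/matrixP => i j.
  have := gram_diag i j.
  rewrite !mul_diag_mx !mul_mx_diag !mxE => /eqP.
  rewrite mulrC -subr_eq0 -mulrBl mulf_eq0 subr_eq0 => /orP [/eqP -> | /eqP ->].
    by rewrite mulrC.
  by rewrite mul0r mulr0.
rewrite /spectral_fun !trmx_mul tr_diag_mx.
apply: (can_inj (mulKmx V_unit)); rewrite trmx_inv !mulmxA gram_fun mulmxV //.
by rewrite mul1mx -!mulmxA mulmxV ?unitmx_tr // mulmx1.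
Qed.

Lemma trace_norm_diag (R : realType) (n : nat) (A V : 'M[R]_n) (d : 'rV[R]_n) :
  A^T = A -> V \in unitmx -> V *m A = diag_mx d *m V ->
  trace_norm A = \sum_i `|d 0 i|.
Proof.
move=> A_sym V_unit VA; rewrite /trace_norm /singular_values big_map.
pose d2 : 'rV[R]_n := \row_i (d 0 i ^+ 2).
have VA2 : V *m (A^T *m A) = diag_mx d2 *m V.
  have -> : d2 = \row_i (d 0 i * d 0 i) by apply/rowP => i; rewrite !mxE expr2.
  by rewrite A_sym mulmxA VA -mulmxA VA mulmxA mulmx_diag.
rewrite (sum_eigenvalues _ (char_poly_similar_diag V_unit VA2)).
rewrite big_map big_enum.
by apply: eq_bigr => i _; rewrite mxE sqrtr_sqr.
Qed.

(** A polar decomposition: S is the sign of A and B is the square root of its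
absolute value. *)
Lemma symmetric_polar (R : realType) (n : nat) (A : 'M[R]_n) :
  A^T = A ->
  exists S B : 'M[R]_n,
    [/\ S^T = S, S *m S = 1%:M, B^T = B, A = S *m (B *m B)
      & \tr (B *m B) = trace_norm A].
Proof.
move=> A_sym; have [V V_unit [d VA]] := symmetric_diagonalizable A_sym.
pose sign (x : R) : R := if 0 <= x then 1 else -1.
exists (spectral_fun V d sign), (spectral_fun V d (fun x => Num.sqrt `|x|)).
split; try exact: spectral_fun_sym VA.
- rewrite spectral_funM // -(spectral_fun1 d V_unit).
  congr (_ *m diag_mx _ *m _).
  by apply/rowP => i; rewrite !mxE /sign; case: ifP; rewrite ?mulrNN mulr1.
- rewrite -{1}(spectral_fun_id V_unit VA) !spectral_funM //.
  congr (_ *m diag_mx _ *m _); apply/rowP => i; rewrite !mxE -expr2.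
  rewrite sqr_sqrtr // /sign.
  by case: ger0P => _; rewrite ?mul1r ?mulN1r ?opprK.
- rewrite (trace_norm_diag A_sym V_unit VA) spectral_funM //.
  rewrite mxtrace_spectral_fun //.
  by apply: eq_bigr => i _; rewrite -expr2 sqr_sqrtr.
Qed.

Lemma trace_norm_attained (R : realType) (n : nat) (A : 'M[R]_n) :
  A^T = A ->
  exists S : 'M[R]_n, [/\ S^T = S, S *m S = 1%:M & trace_norm A = \tr (S *m A)].
Proof.
move=> /symmetric_polar [S [B [S_sym SS _ -> <-]]]; exists S; split=> //.
by rewrite [S *m (S *m _)]mulmxA SS mul1mx.
Qed.

Lemma mxtrace_trmx_mulE (R : comNzRingType) (m n : nat) (X Y : 'M[R]_(m, n)) :
  \tr (X^T *m Y) = \sum_i \sum_j X i j * Y i j.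
Proof.
rewrite exchange_big; apply: eq_bigr => j _; rewrite mxE.
by apply: eq_bigr => i _; rewrite mxE.
Qed.

Lemma mxtrace_gram_ge0 (R : realDomainType) (m n : nat) (X : 'M[R]_(m, n)) :
  0 <= \tr (X^T *m X).
Proof.
rewrite mxtrace_trmx_mulE; apply: sumr_ge0 => i _; apply: sumr_ge0 => j _.
by rewrite -expr2 sqr_ge0.
Qed.

Lemma mxtrace_gram_eq0 (R : realDomainType) (m n : nat) (X : 'M[R]_(m, n)) :
  \tr (X^T *m X) = 0 -> X = 0.
Proof.
have pos i : 0 <= \sum_j X i j * X i j.
  by apply: sumr_ge0 => j _; rewrite -expr2 sqr_ge0.
rewrite mxtrace_trmx_mulE => /psumr_eq0P row0; apply/matrixP => i j.
rewrite mxE; apply/eqP; rewrite -sqrf_eq0 expr2; apply/eqP; move: j isT.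
by apply: psumr_eq0P => [j _|]; [rewrite -expr2 sqr_ge0 | apply: row0].
Qed.

(** With A = S B^2, the gap between the two sides is half the squared Frobenius
norm of Q^T B - S B. *)
Lemma mxtrace_orthogonal_le (R : realType) (n : nat) (A Q : 'M[R]_n) :
  A^T = A -> Q^T *m Q = 1%:M -> \tr (Q *m A) <= trace_norm A.
Proof.
move=> /symmetric_polar [S [B [S_sym SS B_sym -> <-]]] QQ.
have := mxtrace_gram_ge0 (Q^T *m B - S *m B).
have -> : \tr ((Q^T *m B - S *m B)^T *m (Q^T *m B - S *m B))
    = (\tr (B *m B) - \tr (Q *m (S *m (B *m B)))) *+ 2.
  have e1 : \tr (B *m (Q *m (S *m B))) = \tr (Q *m (S *m (B *m B))).
    by rewrite mxtrace_mulC -!mulmxA.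
  have e2 : \tr (B *m (S *m (Q^T *m B))) = \tr (Q *m (S *m (B *m B))).
    by rewrite -e1 -mxtrace_tr !trmx_mul B_sym S_sym trmxK !mulmxA.
  rewrite [(_ - _)^T]linearB /= mulmxBl !mulmxBr !trmx_mul trmxK B_sym S_sym.
  rewrite -!mulmxA (mulmxA Q Q^T) (mulmx1C QQ) mul1mx (mulmxA S S) SS mul1mx.
  rewrite !linearB /= e1 e2; ring.
by rewrite pmulrn_lge0 // subr_ge0.
Qed.

(** * Half-sums and half-differences of symmetric involutions *)

Lemma involution_pair (R : realFieldType) (n : nat) (S T : 'M[R]_n) :
  S^T = S -> S *m S = 1%:M -> T^T = T -> T *m T = 1%:M ->
  exists P D : 'M[R]_n, [/\ S = P + D, T = P - D, P^T = P, D^T = D &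
    P *m P + D *m D = 1%:M /\ P *m D + D *m P = 0].
Proof.
move=> S_sym SS T_sym TT; exists (2^-1 *: (S + T)), (2^-1 *: (S - T)).
have half (M : 'M[R]_n) : M = 2^-1 *: (M + M).
  by rewrite -mulr2n -scaler_nat scalerA mulVf ?scale1r // pnatr_eq0.
split.
- by rewrite -scalerDr addrACA subrr addr0 -half.
- by rewrite -scalerBr opprB [S + T]addrC addrACA subrr addr0 -half.
- by rewrite linearZ /= linearD /= S_sym T_sym.
- by rewrite linearZ /= linearB /= S_sym T_sym.
rewrite -!scalemxAl -!scalemxAr !scalerA -!scalerDr.
rewrite !mulmxDl !mulNmx !mulmxDr !mulmxN SS TT.
move: (S *m T) (T *m S) => X Y.
by split; apply/matrixP => i j; rewrite !mxE; field.
Qed.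

Section Contraction.

Variables (R : realFieldType) (n : nat) (P D : 'M[R]_n).
Hypotheses (P_sym : P^T = P) (D_sym : D^T = D).
Hypothesis PD_sqr : P *m P + D *m D = 1%:M.

(** The matrix I - P is positive semidefinite, because
2 (I - P) = (I - P)^2 + D^2. *)
Lemma contraction_form_ge0 (k : nat) (X : 'M[R]_(n, k)) :
  0 <= \tr (X^T *m X) - \tr (X^T *m P *m X).
Proof.
have := mxtrace_gram_ge0 (D *m X); have := mxtrace_gram_ge0 (X - P *m X).
have -> : \tr ((D *m X)^T *m (D *m X))
    = \tr (X^T *m X) - \tr (X^T *m (P *m (P *m X))).
  rewrite trmx_mul D_sym -!mulmxA -linearB /= -mulmxBr; congr (\tr (_ *m _)).
  rewrite [D *m _]mulmxA [P *m _]mulmxA -[X in X - _]mul1mx -PD_sqr mulmxDl.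
  by rewrite [RHS]addrAC subrr add0r.
have -> : \tr ((X - P *m X)^T *m (X - P *m X))
    = \tr (X^T *m X) - \tr (X^T *m P *m X) *+ 2 + \tr (X^T *m (P *m (P *m X))).
  rewrite [(_ - _)^T]linearB /= mulmxBl !mulmxBr trmx_mul P_sym !mulmxA.
  by rewrite !linearB /=; ring.
by lra.
Qed.

End Contraction.

Section AnticommutingPair.

Variables (R : realFieldType) (n : nat) (P D : 'M[R]_n) (u : 'cV[R]_n).
Hypotheses (P_sym : P^T = P) (D_sym : D^T = D).
Hypothesis PD_sqr : P *m P + D *m D = 1%:M.
Hypothesis PD_anti : P *m D + D *m P = 0.
Hypothesis u_unit : u^T *m u = 1%:M.

(** P^3 = P - P D^2, and P D^2 = - D P D has the trace of its own opposite. *)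
Lemma mxtrace_cube : \tr (P *m P *m P) = \tr P.
Proof.
have PDD0 : \tr (P *m D *m D) = 0.
  have : \tr (P *m D *m D) = - \tr (P *m D *m D).
    rewrite [in LHS](_ : P *m D = - (D *m P)); last first.
      by apply/eqP; rewrite -addr_eq0 PD_anti.
    by rewrite mulNmx linearN /= -[D *m P *m D]mulmxA mxtrace_mulC.
  by lra.
rewrite -[in RHS](mulmx1 P) -PD_sqr mulmxDr linearD /= !mulmxA PDD0.
by rewrite addr0.
Qed.

Let N_sym : (- P)^T = - P. Proof. by rewrite linearN /= P_sym. Qed.
Let ND_sqr : (- P) *m (- P) + D *m D = 1%:M.
Proof. by rewrite mulNmx mulmxN opprK. Qed.

Let p := \tr (u^T *m P *m u).
Let t := \tr P.
Let q := \tr (P *m P).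

Let tr_uu : \tr (u^T *m u) = 1. Proof. by rewrite u_unit mxtrace1. Qed.

Lemma rayleigh_le1 : p <= 1.
Proof.
by have := contraction_form_ge0 P_sym D_sym PD_sqr u; rewrite tr_uu subr_ge0.
Qed.

(** The difference is the trace of P (I - P) P, by [mxtrace_cube]. *)
Lemma trace_le_sqr : t <= q.
Proof.
have := contraction_form_ge0 P_sym D_sym PD_sqr P.
by rewrite P_sym mxtrace_cube subr_ge0.
Qed.

(** The right-hand side is the trace of the positive semidefinite matrix
P (I + P) P, so it is at least the quadratic form of that matrix at the unit
vector u; the latter is bounded by the tangent line at 1 of x^3 + x^2. *)
Lemma rayleigh_le_trace : 5 * p - 3 <= q + t.
Proof.
pose M := P *m (P *m P); pose m2 := \tr (u^T *m (P *m P) *m u).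
pose m3 := \tr (u^T *m M *m u).
have trM : \tr M = t by rewrite /M mulmxA mxtrace_cube.
pose E : 'M[R]_n := 1%:M - u *m u^T.
have E_sym : E^T = E by rewrite /E linearB /= trmx1 trmx_mul trmxK.
have EE : E *m E = E.
  rewrite {1}/E mulmxBl mul1mx /E mulmxBr mulmx1 -mulmxA (mulmxA u^T u) u_unit.
  by rewrite mul1mx subrr subr0.
have compress (X : 'M[R]_n) : \tr (E *m X *m E) = \tr X - \tr (u^T *m X *m u).
  rewrite mxtrace_mulC mulmxA EE /E mulmxBl mul1mx linearB /=.
  by rewrite -[u *m u^T *m X]mulmxA mxtrace_mulC.
(* Compressing P (I + P) P to the orthogonal complement of u leaves a
   nonnegative trace; E is the projection onto that complement. *)
have := contraction_form_ge0 N_sym D_sym ND_sqr (P *m E).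
rewrite mulmxN mulNmx linearN /= trmx_mul E_sym P_sym.
have -> : E *m P *m (P *m E) = E *m (P *m P) *m E by rewrite !mulmxA.
have -> : E *m P *m P *m (P *m E) = E *m M *m E by rewrite /M !mulmxA.
rewrite !compress trM -/m2 -/m3 -/q.
(* At (I - P) u, the matrix P + 3 I = (I + P) + 2 I is nonnegative: this is
   (x - 1)^2 (x + 3) >= 0 evaluated at P. *)
have := contraction_form_ge0 N_sym D_sym ND_sqr (u - P *m u).
have := mxtrace_gram_ge0 (u - P *m u).
have -> : \tr ((u - P *m u)^T *m (u - P *m u)) = 1 - p *+ 2 + m2.
  rewrite [(_ - _)^T]linearB /= mulmxBl !mulmxBr trmx_mul P_sym !mulmxA.
  rewrite !linearB /= tr_uu /m2 /p !mulmxA; ring.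
have -> : \tr ((u - P *m u)^T *m - P *m (u - P *m u)) = - (p - m2 *+ 2 + m3).
  rewrite [(_ - _)^T]linearB /= mulmxN mulNmx linearN /=; congr (- _).
  rewrite mulmxBl mulmxBl !mulmxBr trmx_mul P_sym /M !mulmxA.
  rewrite !linearB /= /m3 /m2 /p /M !mulmxA; ring.
by lra.
Qed.

End AnticommutingPair.

(** It is used with N = n and r = sqrt n / 2, where p is the Rayleigh quotient
of P at u, t = tr P and q = tr P^2.  The coefficients of q + t and q - t are
chosen so that their combination is t + r q; the defect is then a sum of three
nonnegative terms, each of which must vanish in the case of equality. *)
Lemma reflection_defect (R : realFieldType) (N r p t q : R) :
  1 < r -> (1 + r) * 5 < N *+ 2 -> p <= 1 -> t <= q -> 5 * p - 3 <= q + t ->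
  0 <= N * (1 - p) + (t - 1) + r * (q - 1)
  /\ (N * (1 - p) + (t - 1) + r * (q - 1) = 0 -> p = 1 /\ q = 1).
Proof.
move=> r_gt1 N_big p_le1 tq pqt.
pose a := (N - (1 + r) * 5 / 2) * (1 - p).
pose b := (r - 1) / 2 * (q - t).
pose c := (1 + r) / 2 * (q + t - 5 * p + 3).
have a_ge0 : 0 <= a by apply: mulr_ge0; lra.
have b_ge0 : 0 <= b by apply: mulr_ge0; lra.
have c_ge0 : 0 <= c by apply: mulr_ge0; lra.
have -> : N * (1 - p) + (t - 1) + r * (q - 1) = a + b + c.
  by rewrite /a /b /c; field.
split; first by rewrite !addr_ge0.
move=> sum0.
have p1 : 1 - p = 0.
  by apply: (mulfI (x := N - (1 + r) * 5 / 2));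
    [rewrite lt0r_neq0 //|rewrite -/a]; lra.
have tq0 : q - t = 0.
  by apply: (mulfI (x := (r - 1) / 2)); [rewrite lt0r_neq0 //|rewrite -/b]; lra.
have : q + t - 5 * p + 3 = 0.
  by apply: (mulfI (x := (1 + r) / 2)); [rewrite lt0r_neq0 //|rewrite -/c]; lra.
by split; lra.
Qed.

(** * The difference between a matrix and its complement *)

(** This is 2A - J + I; for the adjacency matrix of a graph it is the opposite
of the Seidel matrix. *)
Definition seidel_mx (R : nzRingType) (n : nat) (A : 'M[R]_n) : 'M[R]_n :=
  A - (const_mx 1 - 1%:M - A).

Lemma seidel_mx_sym (R : nzRingType) (n : nat) (A : 'M[R]_n) :
  A^T = A -> (seidel_mx A)^T = seidel_mx A.
Proof.
by move=> A_sym; rewrite /seidel_mx !linearB /= trmx_const trmx1 A_sym.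
Qed.

Lemma seidel_mx_diag (R : nzRingType) (n : nat) (A : 'M[R]_n) i :
  A i i = 0 -> seidel_mx A i i = 0.
Proof. by move=> Aii; rewrite !mxE Aii eqxx mulr1n !subr0 subrr subrr. Qed.

Lemma seidel_mx_offdiag (R : comNzRingType) (n : nat) (A : 'M[R]_n) i j :
  i != j -> seidel_mx A i j = A i j *+ 2 - 1.
Proof. by move=> /negPf ij; rewrite !mxE ij mulr0n; ring. Qed.

(** Off the diagonal, 1 - (2a - 1)^2 = 4 a (1 - a): the gap measures how far the
entries of A are from being 0 or 1. *)
Lemma seidel_mx_gap (R : realDomainType) (n : nat) (A : 'M[R]_n) :
  (forall i, A i i = 0) ->
  n%:R * (n%:R - 1) - \tr ((seidel_mx A)^T *m seidel_mx A)
    = \sum_i \sum_(j | j != i) A i j * (1 - A i j) *+ 4.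
Proof.
move=> A_diag; rewrite mxtrace_trmx_mulE.
have -> : n%:R * (n%:R - 1) = \sum_(i < n) \sum_(j < n | j != i) (1 : R).
  under eq_bigr => i _.
    rewrite sumr_const; have -> : #|(fun j => j != i)| = n.-1.
      by rewrite cardC1 card_ord.
    over.
  rewrite sumr_const card_ord -[RHS]mulr_natl.
  case: (n) => [|k]; first by rewrite !mul0r.
  by rewrite -[X in _ * (X - 1)]natr1 addrK.
rewrite -sumrB; apply: eq_bigr => i _.
rewrite [X in _ - X](bigD1 i) //= seidel_mx_diag // mul0r add0r -sumrB.
apply: eq_bigr => j ji; rewrite seidel_mx_offdiag 1?eq_sym //; ring.
Qed.

Lemma mxtrace_split (R : comNzRingType) (n : nat) (A P D : 'M[R]_n) :
  \tr ((P + D) *m A) + \tr ((P - D) *m (const_mx 1 - 1%:M - A))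
    = \tr (P *m const_mx 1) - \tr P + \tr (D *m seidel_mx A).
Proof.
set B := _ - A; rewrite mulmxDl mulmxBl linearD linearB /=.
have -> : \tr (P *m const_mx 1) - \tr P = \tr (P *m A) + \tr (P *m B).
  by rewrite -linearD -mulmxDr [A + B]addrC /B subrK mulmxBr mulmx1 linearB.
by rewrite /seidel_mx -/B mulmxBr linearB /=; ring.
Qed.

Lemma completed_square (R : realFieldType) (n : nat) (D C : 'M[R]_n) (s : R) :
  \tr (D^T *m C) * s *+ 2 = s ^+ 2 * \tr (D^T *m D) + \tr (C^T *m C)
    - \tr ((s *: D - C)^T *m (s *: D - C)).
Proof.
rewrite !mxtrace_trmx_mulE !big_distrr /= big_distrl /=.
rewrite -sumrMnl -big_split -sumrB /=.
apply: eq_bigr => i _.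
rewrite big_distrr big_distrl /= -sumrMnl -big_split -sumrB /=.
by apply: eq_bigr => j _; rewrite !mxE; ring.
Qed.

(** * The upper bound and its extremal matrices *)

Definition unit_const (R : rcfType) (n : nat) : 'cV[R]_n :=
  const_mx (Num.sqrt n%:R)^-1.

Lemma unit_const_mul_tr (R : rcfType) (n : nat) :
  unit_const R n *m (unit_const R n)^T = n%:R^-1 *: const_mx 1.
Proof.
apply/matrixP => i j; rewrite !mxE big_ord1 !mxE mulr1 -expr2 exprVn.
by rewrite sqr_sqrtr.
Qed.

Lemma unit_const_tr_mul (R : rcfType) (n : nat) :
  (0 < n)%N -> (unit_const R n)^T *m unit_const R n = 1%:M.
Proof.
move=> n_gt0; apply/matrixP => i j; rewrite !ord1 !mxE eqxx.
under eq_bigr => k _ do rewrite !mxE -expr2 exprVn sqr_sqrtr // .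
rewrite sumr_const card_ord -[RHS](@mulVf _ n%:R) ?mulr_natr //.
by rewrite pnatr_eq0 -lt0n.
Qed.

Lemma le_entry_mx_norm (R : realType) (m n : nat) (A : 'M[R]_(m, n)) i j :
  `|A i j| <= mx_norm A.
Proof.
rewrite mx_normrE; exact: (le_bigmax _ (fun ij => `|A ij.1 ij.2|) (i, j)).
Qed.

(** The conditions on r = sqrt n / 2 under which [reflection_defect] applies. *)
Lemma sqrt_gap (R : rcfType) (n : nat) :
  (7 <= n)%N ->
  1 < Num.sqrt n%:R / 2 :> R /\ (1 + Num.sqrt n%:R / 2) * 5 < n%:R *+ 2 :> R.
Proof.
move=> n_ge7; set s : R := Num.sqrt n%:R.
have s_sqr : s ^+ 2 = n%:R by rewrite sqr_sqrtr.
have s_ge0 : 0 <= s by rewrite sqrtr_ge0.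
have : 7 <= n%:R :> R by rewrite ler_nat.
rewrite -s_sqr => s_sqr_ge7.
(* (26 / 10)^2 = 6.76 is below 7, and s = 26 / 10 satisfies both bounds *)
have s_gt : 26 / 10 < s by nra.
by split; nra.
Qed.

(** Up to a factor 2 sqrt n, the difference of the two sides is a sum of three
nonnegative terms: the defect of [reflection_defect] scaled by the same factor,
the gap of [seidel_mx_gap], and the squared Frobenius norm of sqrt n D - C.  In
the case of equality all three vanish. *)
Lemma trace_norm_complement_extremal (R : realType) (n : nat) (A : 'M[R]_n) :
  (7 <= n)%N -> A^T = A -> (forall i j, 0 <= A i j <= 1) ->
  (forall i, A i i = 0) ->
  trace_norm A + trace_norm (const_mx 1 - 1%:M - A)
    <= (n%:R - 1) * (1 + Num.sqrt n%:R)
  /\ (trace_norm A + trace_norm (const_mx 1 - 1%:M - A)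
        = (n%:R - 1) * (1 + Num.sqrt n%:R) ->
      (forall i j, A i j = 0 \/ A i j = 1)
      /\ seidel_mx A *m seidel_mx A = n%:R%:M - const_mx 1).
Proof.
move=> n_ge7 A_sym A_01 A_diag.
have [r_gt1 n_big] := sqrt_gap R n_ge7.
have n_gt0 : (0 < n)%N by apply: leq_trans n_ge7.
have C_sym := seidel_mx_sym A_sym; have C_gap := seidel_mx_gap A_diag.
have B_sym : (const_mx 1 - 1%:M - A)^T = const_mx 1 - 1%:M - A.
  by rewrite !linearB /= trmx_const trmx1 A_sym.
have [S [S_sym SS ->]] := trace_norm_attained A_sym.
have [T [T_sym TT ->]] := trace_norm_attained B_sym.
have [P [D [-> -> P_sym D_sym [PD_sqr PD_anti]]]] :=
  involution_pair S_sym SS T_sym TT.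
rewrite mxtrace_split.
set C := seidel_mx A in C_sym C_gap *; set s := Num.sqrt n%:R in r_gt1 n_big *.
pose u := unit_const R n.
have u_unit : u^T *m u = 1%:M by apply: unit_const_tr_mul.
have s_sqr : s ^+ 2 = n%:R by rewrite sqr_sqrtr.
pose p := \tr (u^T *m P *m u); pose t := \tr P; pose q := \tr (P *m P).
have p_le1 : p <= 1 := rayleigh_le1 P_sym D_sym PD_sqr u_unit.
have tq : t <= q := trace_le_sqr P_sym D_sym PD_sqr PD_anti.
have pqt : 5 * p - 3 <= q + t :=
  rayleigh_le_trace P_sym D_sym PD_sqr PD_anti u_unit.
have [defect_ge0 defect_eq0] := reflection_defect r_gt1 n_big p_le1 tq pqt.
have uu : u *m u^T = n%:R^-1 *: const_mx 1 by apply: unit_const_mul_tr.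
have n_neq0 : n%:R != 0 :> R by rewrite pnatr_eq0; case: (n) n_gt0.
have trPJ : \tr (P *m const_mx 1) = n%:R * p.
  rewrite /p [in RHS]mxtrace_mulC mulmxA uu -scalemxAl linearZ /= mulrA.
  by rewrite mulfV // mul1r mxtrace_mulC.
have trDD : \tr (D^T *m D) = n%:R - q.
  rewrite D_sym -(addKr (P *m P) (D *m D)) PD_sqr linearD linearN /=.
  by rewrite mxtrace1 addrC.
have gap_ge0 i j : 0 <= A i j * (1 - A i j) *+ 4.
  by rewrite mulrn_wge0 // mulr_ge0 ?subr_ge0 //; case/andP: (A_01 i j).
have row_gap_ge0 i : 0 <= \sum_(j | j != i) A i j * (1 - A i j) *+ 4.
  by apply: sumr_ge0 => j _.
have C_norm : \tr (C^T *m C) <= n%:R * (n%:R - 1).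
  by rewrite -subr_ge0 C_gap; apply: sumr_ge0 => i _.
have := mxtrace_gram_ge0 (s *: D - C); have := completed_square D C s.
rewrite trDD s_sqr trPJ -/t D_sym.
set d := \tr (D *m C); set c := \tr (C^T *m C) in C_norm C_gap *.
set e := \tr (_^T *m (s *: D - C)) => square e_ge0.
have s_gt0 : 0 < s by lra.
have defectE : ((n%:R - 1) * (1 + s) - (n%:R * p - t + d)) * s *+ 2
    = (n%:R * (1 - p) + (t - 1) + s / 2 * (q - 1)) * s *+ 2
      + (n%:R * (n%:R - 1) - c) + e.
  have -> : ((n%:R - 1) * (1 + s) - (n%:R * p - t + d)) * s *+ 2
     = ((n%:R - 1) * (1 + s) - (n%:R * p - t)) * s *+ 2 - d * s *+ 2 by ring.
  by rewrite square -s_sqr; field.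
have def_s_ge0 : 0 <= (n%:R * (1 - p) + (t - 1) + s / 2 * (q - 1)) * s *+ 2.
  by rewrite mulrn_wge0 // mulr_ge0 // ltW.
split.
  rewrite -subr_ge0 -(pmulr_lge0 _ s_gt0) -(pmulrn_lge0 _ (n := 2)) // defectE.
  by apply: addr_ge0 => //; apply: addr_ge0 => //; rewrite subr_ge0.
move=> total; move: defectE; rewrite total subrr mul0r mul0rn => sum0.
have gap0 : n%:R * (n%:R - 1) - c = 0 by lra.
have e0 : e = 0 by lra.
have [p1 q1] : p = 1 /\ q = 1.
  by apply: defect_eq0; apply: (mulIf (lt0r_neq0 s_gt0)); lra.
have sDC : s *: D = C.
  by apply/eqP; rewrite -subr_eq0; apply/eqP/mxtrace_gram_eq0.
(* The squared Frobenius norm of P - u u^T is q - 2 p + 1. *)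
have P_J : P = u *m u^T.
  apply/eqP; rewrite -subr_eq0; apply/eqP/mxtrace_gram_eq0.
  rewrite [(_ - _)^T]linearB /= trmx_mul trmxK P_sym mulmxBl !mulmxBr.
  rewrite -[u *m u^T *m (u *m _)]mulmxA (mulmxA u^T u) u_unit mul1mx.
  rewrite !linearB /= -/q q1 mulmxA mxtrace_mulC mulmxA -/p p1.
  rewrite -mulmxA mxtrace_mulC -/p p1 mxtrace_mulC u_unit mxtrace1; ring.
split=> [i j|].
  have [->|ji] := eqVneq j i; first by left.
  move: gap0; rewrite C_gap => /psumr_eq0P row0.
  have /psumr_eq0P ent0 := row0 (fun i _ => row_gap_ge0 i) i isT.
  have /eqP := ent0 (fun j _ => gap_ge0 i j) j ji.
  rewrite mulrn_eq0 /= mulf_eq0 subr_eq0 => /orP [] /eqP; first by left.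
  by move=> <-; right.
rewrite -sDC -scalemxAl -scalemxAr scalerA -expr2 s_sqr.
have -> : D *m D = 1%:M - n%:R^-1 *: const_mx 1.
  rewrite -PD_sqr P_J -mulmxA (mulmxA u^T u) u_unit mul1mx uu.
  by rewrite addrAC subrr add0r.
by rewrite scalerBr scalerA mulfV // scale1r scalemx1.
Qed.

(** * Conference graphs *)

Lemma sum_natr_card (R : nzRingType) (T : finType) (p : pred T) :
  \sum_(k : T) (p k)%:R = #|[set k | p k]|%:R :> R.
Proof.
rewrite -natr_sum -sum1dep_card [in RHS]big_mkcond; apply: congr1.
by apply: eq_bigr => k _; case: (p k).
Qed.

Lemma sum_delta (R : pzRingType) (T : finType) (f : T -> R) (i : T) :
  \sum_k f k * (i == k)%:R = f i.
Proof.
rewrite (bigD1 i) //= eqxx mulr1 big1 ?addr0 // => k.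
by rewrite eq_sym => /negPf ->; rewrite mulr0.
Qed.

Section Graph.

Variables (R : realType) (n : nat) (e : rel 'I_n).
Hypothesis e_sym : symmetric e.

Let deg i := #|[set y | e i y]|.
Let C := seidel_mx (adjacency_mx R e).

Let CE i j : C i j = 2 * (e i j)%:R - 1 + (i == j)%:R.
Proof. by rewrite !mxE; ring. Qed.

Lemma seidel_adjacency_rowsum i :
  (C *m const_mx 1 : 'M_n) i i = (deg i)%:R *+ 2 - n%:R + 1.
Proof.
rewrite mxE; under eq_bigr => k _ do rewrite CE [const_mx _ _ _]mxE mulr1.
rewrite !big_split /= -mulr_sumr sum_natr_card sumr_const card_ord.
rewrite -(eq_bigr _ (fun k _ => mul1r _)) sum_delta -/(deg i); ring.
Qed.

Lemma seidel_adjacency_sqr i j :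
  (C *m C) i j = #|common_nbrs e i j|%:R *+ 4 - (deg i)%:R *+ 2
    - (deg j)%:R *+ 2 + n%:R + (e i j)%:R *+ 4 - 2 + (i == j)%:R.
Proof.
have term k : C i k * C k j =
    4 * (e i k && e j k)%:R - 2 * (e i k)%:R - 2 * (e j k)%:R + 1
    + (2 * (e i k)%:R - 1) * (j == k)%:R
    + (2 * (e j k)%:R - 1 + (j == k)%:R) * (i == k)%:R.
  by rewrite !CE (e_sym k j) (eq_sym k j) -mulnb natrM; ring.
rewrite mxE (eq_bigr _ (fun k _ => term k)) !big_split /= !sum_delta !sumrN.
rewrite -!mulr_sumr !sum_natr_card sumr_const card_ord (e_sym j i) (eq_sym j i).
by rewrite -/(deg i) -/(deg j) /common_nbrs; ring.
Qed.

End Graph.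

Lemma conference_seidel_sqr (R : realType) (n : nat) (e : rel 'I_n) :
  conference_graph e n ->
  seidel_mx (adjacency_mx R e) *m seidel_mx (adjacency_mx R e)
    = n%:R%:M - const_mx 1.
Proof.
move=> [d [l [m [nd nl nm [[e_sym e_irr] _ deg_e adj_e nadj_e]]]]].
have natE (k a b : nat) : (k * a + b = n)%N -> n%:R = a%:R *+ k + b%:R :> R.
  by move=> <-; rewrite natrD mulnC natrM mulr_natr.
have := natE _ _ _ nd; have := natE _ _ _ nl; have := natE _ _ _ nm.
move=> {nd nl nm natE} nm nl nd.
apply/matrixP => i j; rewrite seidel_adjacency_sqr // !deg_e !mxE.
have [<-|ij] := eqVneq i j.
  have -> : common_nbrs e i i = [set y | e i y].
    by apply/setP => k; rewrite !inE andbb.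
  by rewrite deg_e e_irr /= mulr1n mulr0n mulr1n; lra.
rewrite /= !mulr0n; case eij: (e i j).
  by rewrite (adj_e _ _ ij eij) /= mulr1n; lra.
by rewrite (nadj_e _ _ ij (negbT eij)) /= !mulr0n; lra.
Qed.

Lemma const_mx1_sqr (R : pzRingType) (n : nat) :
  (const_mx 1 : 'M[R]_n) *m (const_mx 1 : 'M[R]_n) = n%:R *: const_mx 1.
Proof.
apply/matrixP => i j; rewrite !mxE.
by under eq_bigr => k _ do rewrite !mxE mulr1;
  rewrite sumr_const card_ord mulr1.
Qed.

(** C^2 J = (n I - J) J = 0, so that C J has zero Frobenius norm. *)
Lemma conference_sqr_rowsum0 (R : realFieldType) (n : nat) (C : 'M[R]_n) :
  C^T = C -> C *m C = n%:R%:M - const_mx 1 -> C *m const_mx 1 = 0 :> 'M_n.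
Proof.
move=> C_sym CC; apply: mxtrace_gram_eq0.
rewrite trmx_mul C_sym -mulmxA (mulmxA C C) CC mulmxBl mul_scalar_mx.
by rewrite const_mx1_sqr subrr mulmx0 linear0.
Qed.

(** Zero row sums of C give the degrees, and the off-diagonal entries of C^2
give the numbers of common neighbours.  The parameters are read off at one
adjacent and one nonadjacent pair, which exist because the degree (n - 1) / 2 is
neither 0 nor n - 1. *)
Lemma seidel_sqr_conference (R : realType) (n : nat) (e : rel 'I_n) :
  (1 < n)%N -> symmetric e -> irreflexive e ->
  seidel_mx (adjacency_mx R e) *m seidel_mx (adjacency_mx R e)
    = n%:R%:M - const_mx 1 ->
  conference_graph e n.
Proof.
move=> n_gt1 e_sym e_irr CC.
have C_sym : (seidel_mx (adjacency_mx R e))^T = seidel_mx (adjacency_mx R e).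
  by apply: seidel_mx_sym; apply/matrixP => i j; rewrite !mxE e_sym.
have /matrixP CJ := conference_sqr_rowsum0 C_sym CC.
have degR i : #|[set y | e i y]|%:R *+ 2 = n%:R - 1 :> R.
  by have := CJ i i; rewrite seidel_adjacency_rowsum mxE; lra.
have degE i : (2 * #|[set y | e i y]| + 1)%N = n.
  apply/eqP; rewrite -(eqr_nat R) natrD natrM; apply/eqP.
  by have := degR i; lra.
have cnE i j : i != j -> #|common_nbrs e i j|%:R *+ 4
    = n%:R - 1 - (e i j)%:R *+ 4 :> R.
  move=> ij; have /matrixP /(_ i j) := CC.
  rewrite seidel_adjacency_sqr // !mxE (negPf ij) !mulr0n.
  by have := degR i; have := degR j; lra.
pose x : 'I_n := Ordinal (ltnW n_gt1).
have cn_adj i j : i != j -> e i j -> (4 * #|common_nbrs e i j| + 5)%N = n.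
  move=> ij eij; apply/eqP; rewrite -(eqr_nat R) natrD natrM; apply/eqP.
  by have := cnE i j ij; rewrite eij /= ?mulr0n ?mulr1n; lra.
have cn_nadj i j : i != j -> ~~ e i j -> (4 * #|common_nbrs e i j| + 1)%N = n.
  move=> ij /negPf eij; apply/eqP; rewrite -(eqr_nat R) natrD natrM; apply/eqP.
  by have := cnE i j ij; rewrite eij /= ?mulr0n ?mulr1n; lra.
have [y exy] : exists y, e x y.
  have : (0 < #|[set y | e x y]|)%N.
    by have := degE x; move: (n_gt1); lia.
  by case/card_gt0P => y; rewrite inE => exy; exists y.
have [z xz nexz] : exists2 z, x != z & ~~ e x z.
  apply/exists_inP; apply: contraT.
  rewrite negb_exists_in => /forall_inP all_adj.
  have deg_full : [set y | e x y] = [set~ x].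
    apply/setP => k; rewrite !inE.
    have [->|kx] := eqVneq k x; first exact: e_irr.
    by have := all_adj k; rewrite eq_sym kx negbK => ->.
  by have := degE x; move: (n_gt1); rewrite deg_full cardsC1 card_ord; lia.
have xy : x != y by apply: contraTneq exy => <-; rewrite e_irr.
have inj (k a b c : nat) :
    (0 < k)%N -> (k * a + c = n)%N -> (k * b + c = n)%N -> a = b.
  by move=> k_gt0 <- /addIn /eqP; rewrite eqn_pmul2l // => /eqP.
exists #|[set y | e x y]|, #|common_nbrs e x y|, #|common_nbrs e x z|.
split; [exact: degE|exact: cn_adj|exact: cn_nadj|split=> //].
- exact: card_ord.
- by move=> i; apply: (inj 2%N _ _ 1%N).
- by move=> i j ij eij; apply: (inj 4%N _ _ 5%N) => //; apply: cn_adj.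
- by move=> i j ij eij; apply: (inj 4%N _ _ 1%N) => //; apply: cn_nadj.
Qed.

(** Testing A and its complement against the orthogonal matrices
J / n + C / sqrt n and J / n - C / sqrt n gives exactly the left-hand side. *)
Lemma conference_trace_norm_ge (R : realType) (n : nat) (A : 'M[R]_n) :
  (0 < n)%N -> A^T = A ->
  seidel_mx A *m seidel_mx A = n%:R%:M - const_mx 1 ->
  (n%:R - 1) * (1 + Num.sqrt n%:R)
    <= trace_norm A + trace_norm (const_mx 1 - 1%:M - A).
Proof.
move=> n_gt0 A_sym CC; have C_sym := seidel_mx_sym A_sym.
have CJ := conference_sqr_rowsum0 C_sym CC.
have B_sym : (const_mx 1 - 1%:M - A)^T = const_mx 1 - 1%:M - A.
  by rewrite !linearB /= trmx_const trmx1 A_sym.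
set C := seidel_mx A in C_sym CC CJ.
have n_neq0 : n%:R != 0 :> R by rewrite pnatr_eq0; case: (n) n_gt0.
have s_neq0 : Num.sqrt n%:R != 0 :> R by rewrite sqrtr_eq0 -ltNge ltr0n.
pose P : 'M[R]_n := n%:R^-1 *: const_mx 1; pose D := (Num.sqrt n%:R)^-1 *: C.
have trJ : \tr (const_mx 1 : 'M[R]_n) = n%:R.
  rewrite /mxtrace; under eq_bigr => k _ do rewrite mxE.
  by rewrite sumr_const card_ord.
have P_sym : P^T = P by rewrite linearZ /= trmx_const.
have D_sym : D^T = D by rewrite linearZ /= C_sym.
have DP : D *m P = 0 by rewrite -scalemxAl -scalemxAr CJ !scaler0.
have PD : P *m D = 0 by rewrite -[LHS]trmxK trmx_mul P_sym D_sym DP linear0.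
have PJ : P *m (const_mx 1 : 'M_n) = const_mx 1.
  by rewrite /P -scalemxAl const_mx1_sqr scalerA mulVf // scale1r.
have PP_DD : P *m P + D *m D = 1%:M.
  rewrite {2}/P -scalemxAr PJ -/P -scalemxAl -scalemxAr scalerA CC -invfM.
  rewrite -expr2 sqr_sqrtr // scalerBr addrC subrK -scalemx1 scalerA mulVf //.
  by rewrite scale1r.
have trPD : \tr P = 1 /\ \tr (D *m C) = Num.sqrt n%:R * (n%:R - 1).
  rewrite -scalemxAl CC !linearZ /= linearB /= mxtrace_scalar trJ mulVf //.
  split=> //; rewrite -[n%:R *+ n]mulr_natr; have := sqr_sqrtr (ler0n R n).
  by set s := Num.sqrt _ in s_neq0 * => <-; field.
clearbody P D.
have S_orth : (P + D)^T *m (P + D) = 1%:M.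
  rewrite [(P + D)^T]linearD /= P_sym D_sym mulmxDl !mulmxDr PD DP.
  by rewrite addr0 add0r.
have T_orth : (P - D)^T *m (P - D) = 1%:M.
  rewrite [(P - D)^T]linearB /= P_sym D_sym mulmxBl !mulmxBr PD DP.
  by rewrite subr0 sub0r opprK.
apply: le_trans (lerD (mxtrace_orthogonal_le A_sym S_orth)
                      (mxtrace_orthogonal_le B_sym T_orth)).
have [trP trDC] := trPD; rewrite mxtrace_split -/C PJ trJ trP trDC.
by rewrite le_eqVlt; apply/orP; left; apply/eqP; ring.
Qed.

Theorem theorem2 (R : realType) (n : nat) (A : 'M[R]_n)
    (hn : (7 <= n)%N)
    (A_sym : A^T = A)
    (A_ge0 : forall i j, 0 <= A i j)
    (A_le1 : mx_norm A <= 1)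
    (A_diag : forall i, A i i = 0) :
  trace_norm A + trace_norm (const_mx 1 - 1%:M - A)
    <= (n%:R - 1) * (1 + Num.sqrt n%:R)
  /\ (trace_norm A + trace_norm (const_mx 1 - 1%:M - A)
        = (n%:R - 1) * (1 + Num.sqrt n%:R)
      <-> exists e : rel 'I_n,
            conference_graph e n /\ A = adjacency_mx R e).
Proof.
have A_01 i j : 0 <= A i j <= 1.
  rewrite A_ge0 (le_trans (ler_norm _)) //.
  by rewrite (le_trans (le_entry_mx_norm A i j)).
have [bound extremal] := trace_norm_complement_extremal hn A_sym A_01 A_diag.
split=> //; split=> [/extremal [A_bool CC]|[e [e_conf A_e]]].
  pose e : rel 'I_n := fun i j => A i j == 1.
  have A_e : A = adjacency_mx R e.
    apply/matrixP => i j; rewrite mxE /e.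
    by have [->|->] := A_bool i j; rewrite ?eqxx // eq_sym oner_eq0.
  exists e; split=> //; apply: (@seidel_sqr_conference R).
  - exact: leq_trans hn.
  - by move=> i j; rewrite /e -[in LHS]A_sym mxE.
  - by move=> i; rewrite /e A_diag eq_sym oner_eq0.
  - by rewrite -A_e.
apply/eqP; rewrite eq_le bound /=; apply: conference_trace_norm_ge => //.
- exact: leq_trans hn.
- by rewrite A_e; apply: conference_seidel_sqr.
Qed.
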